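(* Every proper Gromov hyperbolic $\mathrm{CAT}(0)$ space $Y$ is boundary continuous.
   Context: For a metric space $Y$ the Gromov product is $(x|y)_o=\frac12(|xo|+|yo|-|xy|)$, $x,y,o\in Y$. A geodesic metric space $Y$ is Gromov hyperbolic if for some $\delta\ge0$ and every geodesic triangle $xyz\subset Y$: if $y'\in xy$, $z'\in xz$ satisfy $|xy'|=|xz'|\le(y|z)_x$, then $|y'z'|\le\delta$. Points of the boundary at infinity $\partial_\infty Y$ are equivalence classes of sequences converging at infinity (two such sequences $\{x_i\},\{y_i\}$ being equivalent if $(x_i|y_i)_o\to\infty$), and $\{x_i\}\in\xi$ means that $\{x_i\}$ represents $\xi$. A Gromov hyperbolic space $Y$ is boundary continuous if the Gromov product extends continuously to $\partial_\infty Y$ in the following sense: for every $o\in Y$, all $\xi,\eta\in\partial_\infty Y$ and any sequences $\{x_i\}\in\xi$, $\{y_i\}\in\eta$, the limit $(\xi|\eta)_o=\lim_i(x_i|y_i)_o\in[0,\infty]$ exists (and hence is independent of the choice of the sequences). Proper means that closed balls are compact. *)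

(* Defs.v *)
From mathcomp Require Import all_boot all_order all_algebra.
From mathcomp Require Import all_classical all_reals all_analysis.

Set Implicit Arguments.
Unset Strict Implicit.
Unset Printing Implicit Defensive.

Import Order.TTheory GRing.Theory Num.Theory.
Import numFieldNormedType.Exports.

Local Open Scope classical_set_scope.
Local Open Scope ring_scope.

Section MetricSpaces.
Context {R : realType}.
Implicit Type Y : metricType R.

(* (x|y)_o *)
Definition gromov_product Y (o x y : Y) : R :=
  (mdist x o + mdist y o - mdist x y) / 2.

(* The library's [closed_ball] is the closure of the open ball, which may be
   smaller than the metric closed ball. *)
Definition proper_space Y : Prop :=
  forall (x : Y) (r : R), compact [set y | mdist x y <= r].

Definition geodesic_path Y (x y : Y) (c : R -> Y) : Prop :=
  [/\ c 0 = x, c (mdist x y) = y &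
      {in `[0, mdist x y] &, forall s t : R, mdist (c s) (c t) = `|s - t|}].

Definition geodesic_segment Y (x y : Y) (S : set Y) : Prop :=
  exists2 c : R -> Y, geodesic_path x y c & S = c @` `[0, mdist x y].

Definition geodesic_space Y : Prop :=
  forall x y : Y, exists S : set Y, geodesic_segment x y S.

Definition geodesic_triangle Y (x y z : Y) (Sxy Syz Sxz : set Y) : Prop :=
  [/\ geodesic_segment x y Sxy, geodesic_segment y z Syz &
      geodesic_segment x z Sxz].

Definition gromov_hyperbolic Y : Prop :=
  geodesic_space Y /\
  exists2 delta : R, 0 <= delta &
    forall (x y z : Y) (Sxy Syz Sxz : set Y),
      geodesic_triangle x y z Sxy Syz Sxz ->
      forall y' z' : Y, Sxy y' -> Sxz z' ->
        mdist x y' = mdist x z' -> mdist x z' <= gromov_product x y z ->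
        mdist y' z' <= delta.

(* The Euclidean distance of the plane; the library's norm on ['rV[R]_2] is the
   sup norm. *)
Definition plane_dist (u v : 'rV[R]_2) : R :=
  Num.sqrt (\sum_(i < 2) (u 0 i - v 0 i) ^+ 2).

Definition plane_segment (u v : 'rV[R]_2) : set 'rV[R]_2 :=
  [set u + t *: (v - u) | t in `[0, 1]].

Definition comparison_triangle Y (x y z : Y) (u v w : 'rV[R]_2) : Prop :=
  [/\ plane_dist u v = mdist x y, plane_dist v w = mdist y z &
      plane_dist u w = mdist x z].

(* [p'] in [[u, v]] corresponds to the point [p] of the side [S] from [x] to
   [y]; [u, v] are the comparison vertices for [x, y]. *)
Definition comparison_on_side Y (x y : Y) (S : set Y) (u v : 'rV[R]_2)
    (p : Y) (p' : 'rV[R]_2) : Prop :=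
  [/\ S p, plane_segment u v p' & plane_dist u p' = mdist x p].

Definition comparison_point Y (x y z : Y) (Sxy Syz Sxz : set Y)
    (u v w : 'rV[R]_2) (p : Y) (p' : 'rV[R]_2) : Prop :=
  [\/ comparison_on_side x y Sxy u v p p',
      comparison_on_side y z Syz v w p p' |
      comparison_on_side x z Sxz u w p p'].

Definition cat0 Y : Prop :=
  geodesic_space Y /\
  forall (x y z : Y) (Sxy Syz Sxz : set Y) (u v w : 'rV[R]_2),
    geodesic_triangle x y z Sxy Syz Sxz ->
    comparison_triangle x y z u v w ->
    forall (p q : Y) (p' q' : 'rV[R]_2),
      comparison_point x y z Sxy Syz Sxz u v w p p' ->
      comparison_point x y z Sxy Syz Sxz u v w q q' ->
      mdist p q <= plane_dist p' q'.

(* (x_i|x_j)_o -> oo as i and j tend to infinity independently.  Changing [o]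
   alters the products by a bounded amount, so quantifying over all base points
   is the same as fixing one; likewise in [equivalent_at_infinity]. *)
Definition converges_at_infinity Y (x : nat -> Y) : Prop :=
  forall o : Y,
    gromov_product o (x ij.1) (x ij.2) @[ij --> (\oo, \oo)] --> +oo.

Definition equivalent_at_infinity Y (x y : nat -> Y) : Prop :=
  forall o : Y, gromov_product o (x i) (y i) @[i --> \oo] --> +oo.

(* A boundary point is the set of all sequences representing it, so [{x_i} in
   xi] is [xi x]. *)
Definition boundary_at_infinity Y : set (set (nat -> Y)) :=
  [set [set y | converges_at_infinity y /\ equivalent_at_infinity x y]
     | x in [set x | converges_at_infinity x]].

Definition boundary_continuous Y : Prop :=
  forall (o : Y) (xi eta : set (nat -> Y)),
    boundary_at_infinity xi -> boundary_at_infinity eta ->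
    exists2 l : \bar R, (0 <= l)%E &
      forall x y : nat -> Y, xi x -> eta y ->
        (gromov_product o (x i) (y i))%:E @[i --> \oo] --> l.

End MetricSpaces.

Arguments proper_space {R} Y.
Arguments geodesic_space {R} Y.
Arguments gromov_hyperbolic {R} Y.
Arguments cat0 {R} Y.
Arguments boundary_at_infinity {R} Y.
Arguments boundary_continuous {R} Y.

(* Main.v *)
(* By the CAT(0) inequality the functions [z |-> |xz| - |xo|] converge uniformly
   on bounded sets as [x] tends to a boundary point. If [(x|y)_o] stays bounded,
   hyperbolicity yields a point [z] of the geodesic [x y] at bounded distance
   from [o], and
     2 (x|y)_o = - (|xz| - |xo|) - (|yz| - |yo|),
   whereas for other endpoints [x'], [y'] the triangle inequality through [z]
   gives [>=]. Hence the products of sequences converging to distinct boundary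
   points are Cauchy, with a common limit; for equal boundary points they tend
   to [+oo] by the ultrametric inequality. *)

Require Import Defs.
From mathcomp Require Import all_boot all_order all_algebra.
From mathcomp Require Import all_classical all_reals all_analysis.
From mathcomp Require Import ring lra.

Set Implicit Arguments.
Unset Strict Implicit.
Unset Printing Implicit Defensive.

Import Order.TTheory GRing.Theory Num.Theory.
Import numFieldNormedType.Exports.

Local Open Scope classical_set_scope.
Local Open Scope ring_scope.

(** * Symmetry and bounds of the Gromov product *)

Section GromovProduct.
Context {R : realType} {Y : metricType R}.
Implicit Types o x y z : Y.

Lemma gromov_productC o x y : gromov_product o x y = gromov_product o y x.
Proof. by rewrite /gromov_product (metric_sym x y) [X in X - _]addrC. Qed.

Lemma gromov_product_ge0 o x y : 0 <= gromov_product o x y.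
Proof.
rewrite /gromov_product; have := metric_triangle x o y.
by rewrite (metric_sym o y); lra.
Qed.

Lemma gromov_product_le o x y : gromov_product o x y <= mdist o x.
Proof.
rewrite /gromov_product (metric_sym o x); have := metric_triangle y x o.
by rewrite (metric_sym y x); lra.
Qed.

End GromovProduct.

(** * Distances along geodesic paths *)

Section Geodesics.
Context {R : realType} {Y : metricType R}.
Implicit Types (o x y z : Y) (c : R -> Y).

Lemma geodesic_pathP x y : geodesic_space Y -> exists c, geodesic_path x y c.
Proof. by move=> /(_ x y)[S [c cP _]]; exists c. Qed.

Lemma geodesic_path_dist x y c s t : geodesic_path x y c ->
  0 <= s <= mdist x y -> 0 <= t <= mdist x y -> mdist (c s) (c t) = `|s - t|.
Proof. by move=> [_ _ h] hs ht; apply: h; rewrite in_itv. Qed.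

Lemma geodesic_path_distl x y c t : geodesic_path x y c ->
  0 <= t <= mdist x y -> mdist x (c t) = t.
Proof.
move=> cP ht; have [c0 _ _] := cP.
rewrite -{1}c0 (geodesic_path_dist cP _ ht); last by rewrite lexx mdist_ge0.
by rewrite sub0r normrN ger0_norm//; case/andP: ht.
Qed.

Lemma geodesic_path_distr x y c t : geodesic_path x y c ->
  0 <= t <= mdist x y -> mdist (c t) y = mdist x y - t.
Proof.
move=> cP ht; have [_ c1 _] := cP.
rewrite -{1}c1 (geodesic_path_dist cP ht); last by rewrite lexx mdist_ge0.
by rewrite distrC ger0_norm// subr_ge0; case/andP: ht.
Qed.

Lemma geodesic_path_restrict x y c t : geodesic_path x y c ->
  0 <= t <= mdist x y -> geodesic_path x (c t) c.
Proof.
move=> cP ht; have [c0 _ _] := cP.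
rewrite /geodesic_path (geodesic_path_distl cP ht); split=> // a b.
rewrite !in_itv/= => /andP[a0 at_] /andP[b0 bt].
have /andP[_ tx] := ht.
by apply: (geodesic_path_dist cP); apply/andP; split=> //; apply: le_trans tx.
Qed.

End Geodesics.

(** * Consequences of thin triangles *)

Section Hyperbolic.
Context {R : realType} {Y : metricType R}.
Implicit Types (o x y z : Y) (c : R -> Y).

(** Hyperbolicity with the sides at [o] parametrized by arc length, so that the side opposite to [o]
    drops out. *)
Definition thin_triangles (delta : R) : Prop :=
  forall o x y c c' t, geodesic_path o x c -> geodesic_path o y c' ->
    0 <= t <= gromov_product o x y -> mdist (c t) (c' t) <= delta.

Lemma hyperbolic_thin : gromov_hyperbolic Y ->
  exists2 delta : R, 0 <= delta & thin_triangles delta.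
Proof.
move=> [geoY [delta delta0 thin]]; exists delta => // o x y c c' t cP cP'.
move=> /andP[t0 txy].
have tx : 0 <= t <= mdist o x.
  by rewrite t0/= (le_trans txy)// gromov_product_le.
have ty : 0 <= t <= mdist o y.
  by rewrite t0/= (le_trans txy)// gromov_productC gromov_product_le.
have [S SP] := geoY x y.
apply: (thin o x y (c @` `[0, mdist o x]) S (c' @` `[0, mdist o y])).
- by split=> //; [exists c|exists c'].
- by exists t => //=; rewrite in_itv.
- by exists t => //=; rewrite in_itv.
- by rewrite (geodesic_path_distl cP tx) (geodesic_path_distl cP' ty).
- by rewrite (geodesic_path_distl cP' ty).
Qed.

Variable delta : R.
Hypotheses (geoY : geodesic_space Y) (delta0 : 0 <= delta).
Hypothesis thin : thin_triangles delta.

(** At distance [A] from [o], the geodesics to [x] and to [y] are both [delta]-close to the one to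
    [z]. The path from [x] to [y] through these three points has length at most |ox| + |oy| - 2A + 2
    [delta]. *)
Lemma gromov_product_ultra o x y z A :
  A <= gromov_product o x z -> A <= gromov_product o z y ->
  A - delta <= gromov_product o x y.
Proof.
move=> xz zy; have [A0|A0] := leP 0 A; last first.
  by have := gromov_product_ge0 o x y; move: delta0; lra.
have [c cP] := geodesic_pathP o x geoY.
have [c' cP'] := geodesic_pathP o y geoY.
have [d dP] := geodesic_pathP o z geoY.
have Ax : 0 <= A <= mdist o x.
  by rewrite A0 (le_trans xz)// gromov_product_le.
have Ay : 0 <= A <= mdist o y.
  by rewrite A0 (le_trans zy)// gromov_productC gromov_product_le.
have := thin cP dP; move=> /(_ A); rewrite A0 => /(_ xz) h1.
have := thin dP cP'; move=> /(_ A); rewrite A0 => /(_ zy) h2.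
have := metric_triangle (c A) (d A) (c' A).
have := metric_triangle x (c A) y; have := metric_triangle (c A) (c' A) y.
rewrite (geodesic_path_distr cP' Ay) (metric_sym x (c A)).
rewrite (geodesic_path_distr cP Ax) /gromov_product.
by rewrite (metric_sym x o) (metric_sym y o); lra.
Qed.

(** Thinness is applied at the vertex [x], at distance (y|o)_x from it: the point reached on the
    side to [o] is at distance |xo| - (y|o)_x = (x|y)_o from [o]. *)
Lemma geodesic_near_basepoint o x y : exists2 z,
  mdist x z + mdist z y = mdist x y & mdist o z <= gromov_product o x y + delta.
Proof.
have [c cP] := geodesic_pathP x y geoY.
have [d dP] := geodesic_pathP x o geoY.
set t := gromov_product x y o.
have t0 : 0 <= t := gromov_product_ge0 _ _ _.
have ty : 0 <= t <= mdist x y by rewrite t0 gromov_product_le.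
have to : 0 <= t <= mdist x o by rewrite t0 /t gromov_productC gromov_product_le.
exists (c t).
  by rewrite (geodesic_path_distl cP ty) (geodesic_path_distr cP ty); lra.
have /(thin cP dP) : 0 <= t <= gromov_product x y o by rewrite t0 lexx.
have := metric_triangle o (d t) (c t).
rewrite (metric_sym (c t)) (metric_sym o (d t)) (geodesic_path_distr dP to).
rewrite /t /gromov_product (metric_sym y x) (metric_sym o x).
by lra.
Qed.

End Hyperbolic.

(** * Coordinates in the comparison plane *)

Section Plane.
Context {R : realType}.
Implicit Types a b : R.

Definition plane_point a b : 'rV[R]_2 := \row_i [:: a; b]`_i.

Lemma plane_distE a b a' b' :
  plane_dist (plane_point a b) (plane_point a' b') =
  Num.sqrt ((a - a') ^+ 2 + (b - b') ^+ 2).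
Proof. by rewrite /plane_dist !big_ord_recl big_ord0 addr0 !mxE. Qed.

Lemma plane_point_lerp a b a' b' t :
  plane_point a b + t *: (plane_point a' b' - plane_point a b) =
  plane_point (a + t * (a' - a)) (b + t * (b' - b)).
Proof. by apply/rowP => -[[|[|//]] i]; rewrite !mxE. Qed.

End Plane.

(** * Metric inequalities from CAT(0) comparison *)

Section Cat0.
Context {R : realType} {Y : metricType R}.
Implicit Types (o x y z : Y) (c : R -> Y).

(** Comparison of [c s] with the opposite vertex [z]; the Euclidean distance is given by Stewart's
    theorem, multiplied through by |xy|. *)
Lemma cat0_stewart x y z c s : cat0 Y -> geodesic_path x y c ->
  0 <= s <= mdist x y ->
  mdist x y * mdist (c s) z ^+ 2 <=
  (mdist x y - s) * mdist x z ^+ 2 + s * mdist y z ^+ 2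
  - s * (mdist x y - s) * mdist x y.
Proof.
move=> [geoY cmp] cP hs; have /andP[s0 sl] := hs.
have [a0|a0] := eqVneq (mdist x y) 0.
  have -> : s = 0 by apply/eqP; rewrite eq_le s0 -a0 sl.
  by rewrite a0 !(mul0r, subr0, addr0).
have {}a0 : 0 < mdist x y by rewrite lt_neqAle eq_sym a0 mdist_ge0.
have b0 : 0 <= mdist x z := mdist_ge0 _ _.
have e0 : 0 <= mdist y z := mdist_ge0 _ _.
have t1 := metric_triangle x y z.
have t2 := metric_triangle x z y; rewrite (metric_sym z y) in t2.
have t3 := metric_triangle y x z; rewrite (metric_sym y x) in t3.
have [Sxz SxzP] := geoY x z; have [Syz SyzP] := geoY y z.
set S := c @` `[0, mdist x y].
have SP : geodesic_segment x y S by exists c.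
have xp := geodesic_path_distl cP hs.
have Sp : S (c s) by exists s => //=; rewrite in_itv.
set a := mdist x y in a0 t1 t2 t3 hs sl S SP Sp *.
set b := mdist x z in b0 t1 t2 t3 *.
set e := mdist y z in e0 t1 t2 t3 *.
(* By the law of cosines, [al] is the first coordinate of [w] when [u] is the origin and [v] lies on
   the first axis. The triangle inequalities give |al| <= b, so the second coordinate exists. *)
pose al := (a ^+ 2 + b ^+ 2 - e ^+ 2) / (2 * a).
have alE : 2 * a * al = a ^+ 2 + b ^+ 2 - e ^+ 2.
  by rewrite mulrC divfK// mulf_neq0// ?gt_eqF.
have al_le : al <= b.
  by rewrite -(@ler_pM2l _ (2 * a)) ?mulr_gt0// alE; nra.
have al_ge : - b <= al.
  by rewrite -(@ler_pM2l _ (2 * a)) ?mulr_gt0// alE; nra.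
have be0 : 0 <= b ^+ 2 - al ^+ 2 by nra.
pose u := plane_point (0 : R) 0; pose v := plane_point a 0.
pose w := plane_point al (Num.sqrt (b ^+ 2 - al ^+ 2)).
have uvw : comparison_triangle x y z u v w.
  rewrite /comparison_triangle !plane_distE; split.
  - by rewrite subrr expr0n addr0 sub0r sqrrN sqrtr_sqr gtr0_norm.
  - rewrite sub0r sqrrN sqr_sqrtr// -[RHS]ger0_norm// -sqrtr_sqr.
    by congr Num.sqrt; rewrite -/e; nra.
  - by rewrite !sub0r !sqrrN sqr_sqrtr// addrC subrK sqrtr_sqr ger0_norm.
have cp : comparison_point x y z S Syz Sxz u v w (c s) (plane_point s 0).
  apply: Or31; split=> //.
    exists (s / a) => /=.
      by rewrite in_itv/= divr_ge0 ?(ltW a0)//= ler_pdivrMr// mul1r.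
    rewrite plane_point_lerp subrr mulr0 addr0 subr0 add0r divfK//.
    by rewrite gt_eqF.
  by rewrite plane_distE subrr expr0n addr0 sub0r sqrrN sqrtr_sqr xp ger0_norm.
have cq : comparison_point x y z S Syz Sxz u v w z w.
  have [d [_ d1 _] dE] := SyzP.
  apply: Or32; split; last by case: uvw.
  - by rewrite dE; exists e => //=; rewrite in_itv/= lexx e0.
  - by exists 1 => /=; rewrite ?in_itv/= ?lexx ?ler01// scale1r addrC subrK.
have := cmp x y z S Syz Sxz u v w (And3 SP SyzP SxzP) uvw _ _ _ _ cp cq.
rewrite plane_distE sub0r sqrrN sqr_sqrtr// => h.
have {}h : mdist (c s) z ^+ 2 <= (s - al) ^+ 2 + (b ^+ 2 - al ^+ 2).
  have D0 : 0 <= (s - al) ^+ 2 + (b ^+ 2 - al ^+ 2) by rewrite addr_ge0 ?sqr_ge0.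
  by rewrite -(sqr_sqrtr D0) ler_sqr ?nnegrE ?mdist_ge0 ?sqrtr_ge0.
by rewrite -(ler_pM2l a0) in h; nra.
Qed.

(* Stewart's inequality is used in the triangle [o, c t, c' s] and then in the
   triangle [o, c' t, c t]; the distance from [c t] to [c' s] cancels. *)
Lemma cat0_shrink o x y c c' s t : cat0 Y ->
  geodesic_path o x c -> geodesic_path o y c' ->
  0 <= s -> s <= t -> t <= mdist o x -> t <= mdist o y ->
  t * mdist (c s) (c' s) <= s * mdist (c t) (c' t).
Proof.
move=> Ycat cP cP' s0 st tx ty; have t0 := le_trans s0 st.
have htx : 0 <= t <= mdist o x by rewrite t0.
have hty : 0 <= t <= mdist o y by rewrite t0.
have hsx : 0 <= s <= mdist o x by rewrite s0 (le_trans st).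
have hsy : 0 <= s <= mdist o y by rewrite s0 (le_trans st).
have := cat0_stewart (c' s) Ycat (geodesic_path_restrict cP htx).
move=> /(_ s); rewrite (geodesic_path_distl cP htx) s0 => /(_ st).
rewrite (geodesic_path_distl cP' hsy) => h1.
have := cat0_stewart (c t) Ycat (geodesic_path_restrict cP' hty).
move=> /(_ s); rewrite (geodesic_path_distl cP' hty) s0 => /(_ st).
rewrite (geodesic_path_distl cP htx) (metric_sym (c' s)) (metric_sym (c' t)).
have := mdist_ge0 (c s) (c' s); have := mdist_ge0 (c t) (c' t).
move: h1; move: (mdist (c s) _) (mdist (c t) _) (mdist (c t) _) => A D B h1 D0 A0 h2.
have h3 : (t * A) ^+ 2 <= (s * D) ^+ 2.
  by have := ler_wpM2l t0 h1; have := ler_wpM2l s0 h2; nra.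
by move: h3; rewrite ler_sqr// nnegrE mulr_ge0.
Qed.

(** The detour from [x] to [z] through [c s] becomes nearly free as [s] grows, so [x] and [c s] have
    nearly the same Busemann function on the ball of radius [r]. *)
Lemma cat0_excess o x z c s r : cat0 Y -> geodesic_path o x c ->
  mdist o z <= r -> r < s -> s <= mdist o x ->
  mdist (c s) z + (mdist o x - s) - mdist x z <= r ^+ 2 / (2 * (s - r)).
Proof.
move=> Ycat cP zr rs sx.
have z0 : 0 <= mdist o z := mdist_ge0 _ _.
have r0 := le_trans z0 zr; have s0 := le_lt_trans r0 rs.
have := cat0_stewart z Ycat cP; move=> /(_ s); rewrite (ltW s0) => /(_ sx).
have t1 := metric_triangle o z x; rewrite (metric_sym z) in t1.
have t2 := metric_triangle x o z; rewrite (metric_sym x o) in t2.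
move: (mdist_ge0 (c s) z) => A0.
set A := mdist (c s) z in A0 *; set L := mdist o x in sx t1 t2 *.
set d := mdist x z in t1 t2 *; set e := mdist o z in z0 zr t1 t2 *.
have L0 : 0 < L by lra.
(* The excess is [A - w]. Stewart's inequality bounds [A ^+ 2 - w ^+ 2] by [r ^+ 2], and [A + w] is
   at least [2 * (s - r)] when [A > w]. *)
pose w := s - (L - d) => h.
have h1 : A ^+ 2 <= w ^+ 2 + r ^+ 2.
  rewrite -(ler_pM2l L0).
  have he : (L - s) * (e ^+ 2 - (L - d) ^+ 2) <= L * r ^+ 2.
    apply: (@le_trans _ _ ((L - s) * r ^+ 2)); last first.
      by rewrite ler_wpM2r ?sqr_ge0//; lra.
    apply: ler_wpM2l; first lra.
    have : e ^+ 2 <= r ^+ 2 by rewrite ler_sqr.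
    by have := sqr_ge0 (L - d); lra.
  have -> : L * (w ^+ 2 + r ^+ 2) =
      ((L - s) * e ^+ 2 + s * d ^+ 2 - s * (L - s) * L)
      + (L * r ^+ 2 - (L - s) * (e ^+ 2 - (L - d) ^+ 2)).
    by rewrite /w; ring.
  by lra.
have -> : A + (L - s) - d = A - w by rewrite /w; lra.
rewrite ler_pdivlMr; last by lra.
have sw : s - r <= w by rewrite /w; lra.
have [Aw|Aw] := leP A w.
  apply: (@le_trans _ _ 0); last exact: sqr_ge0.
  by apply: mulr_le0_ge0; lra.
apply: (@le_trans _ _ ((A - w) * (A + w))); last by lra.
by apply: ler_wpM2l; lra.
Qed.

End Cat0.

(** * Busemann functions and products near infinity *)

Section Hyperbolic_cat0.
Context {R : realType} {Y : metricType R}.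
Variable delta : R.
Hypotheses (Ycat : cat0 Y) (delta0 : 0 <= delta) (thin : @thin_triangles R Y delta).
Implicit Types (o x y z : Y).

(* The Busemann functions [z |-> |xz| - |xo|] and [z |-> |x'z| - |x'o|] are
   both close to [z |-> |qz| - |qo|] for [q] on the geodesic from [o] far
   compared to [r], and the two points [q] are close to each other because the
   geodesics stay [delta]-close up to a much larger distance. *)
Lemma busemann_close (r eps : R) : 0 <= r -> 0 < eps ->
  exists T : R, forall o x x' z, mdist o z <= r -> T <= gromov_product o x x' ->
    mdist x z - mdist x o <= mdist x' z - mdist x' o + eps.
Proof.
move=> r0 eps0.
have [geoY _] := Ycat.
have re0 : 0 <= r ^+ 2 / eps by rewrite divr_ge0 ?sqr_ge0// ltW.
have de0 : 0 <= delta / eps by rewrite divr_ge0// ltW.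
(* [s] makes the excess at most [eps / 2]; [t] is so large that a gap [delta] at [t] shrinks to at
   most [eps / 2] at [s]. *)
pose s := r + 1 + r ^+ 2 / eps.
pose t := s * (1 + 2 * (delta / eps)).
have s0 : 0 < s by rewrite /s; lra.
have rs : r < s by rewrite /s; lra.
have st : s <= t by rewrite /t ler_peMr ?(ltW s0)//; lra.
have t0 : 0 < t by apply: lt_le_trans st.
exists t => o x x' z zr txx'.
have tx : t <= mdist o x by rewrite (le_trans txx')// gromov_product_le.
have tx' : t <= mdist o x'.
  by rewrite (le_trans txx')// gromov_productC gromov_product_le.
have [c cP] := geodesic_pathP o x geoY.
have [c' cP'] := geodesic_pathP o x' geoY.
have hs : 0 <= s <= mdist o x by rewrite (ltW s0) (le_trans st).
have hs' : s <= mdist o x' by rewrite (le_trans st).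
have h1 : mdist (c s) (c' s) <= eps / 2.
  rewrite -(ler_pM2l t0).
  apply: (le_trans (cat0_shrink Ycat cP cP' (ltW s0) st tx tx')).
  have -> : t * (eps / 2) = s * (eps / 2 + delta).
    by rewrite /t; field; rewrite gt_eqF.
  have /(thin cP cP') : 0 <= t <= gromov_product o x x' by rewrite (ltW t0).
  by move=> ?; apply: ler_wpM2l; [exact: ltW|lra].
have h2 : r ^+ 2 / (2 * (s - r)) <= eps / 2.
  rewrite ler_pdivrMr; last by lra.
  have -> : eps / 2 * (2 * (s - r)) = eps + r ^+ 2.
    by rewrite /s; field; rewrite gt_eqF.
  by lra.
(* The excess bound serves the side of [x']; on the side of [x] the triangle inequality through
   [c s] suffices. *)
have := cat0_excess Ycat cP' zr rs hs'.
have := metric_triangle x (c s) z; rewrite (metric_sym x (c s)).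
rewrite (geodesic_path_distr cP hs).
have := metric_triangle (c s) (c' s) z.
by rewrite (metric_sym x o) (metric_sym x' o); lra.
Qed.

(* Move the endpoints of [x y] to [x'] and [y'] seen from a point [z] of [x y]
   at bounded distance from [o]. *)
Lemma gromov_product_close (M eps : R) : 0 < eps ->
  exists T : R, forall o x y x' y', gromov_product o x y <= M ->
    T <= gromov_product o x x' -> T <= gromov_product o y y' ->
    gromov_product o x y - eps <= gromov_product o x' y'.
Proof.
move=> eps0.
have r0 : 0 <= `|M| + delta by rewrite addr_ge0.
have [T TP] := busemann_close r0 eps0.
have [geoY _] := Ycat.
exists T => o x y x' y' xyM xx' yy'.
have [z zxy oz] := geodesic_near_basepoint geoY thin o x y.
have {}oz : mdist o z <= `|M| + delta.
  by rewrite (le_trans oz)// lerD2r (le_trans xyM)// ler_norm.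
rewrite gromov_productC in xx'; rewrite gromov_productC in yy'.
have := TP _ _ _ _ oz xx'; have := TP _ _ _ _ oz yy'.
have := metric_triangle x' z y'.
rewrite (metric_sym y' z) (metric_sym y z) /gromov_product.
by lra.
Qed.

(** The chain [x i], [x0 i], [x0 j], [x' j] through the defining sequence [x0] takes two ultrametric
    steps, each costing [delta]. *)
Lemma boundary_gromov_product xi : boundary_at_infinity Y xi ->
  forall (x x' : nat -> Y) o T, xi x -> xi x' ->
  exists N, forall i j, (N <= i)%N -> (N <= j)%N ->
    T <= gromov_product o (x i) (x' j).
Proof.
move=> [x0 x0c <-] x x' o T [_ xe] [_ xe'].
have [geoY _] := Ycat.
pose A := T + 2 * delta.
have [[P Q]/= [[a _ aP] [b _ bQ]] PQ] : \forall ij \near (\oo, \oo),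
    A <= gromov_product o (x0 ij.1) (x0 ij.2).
  by move/cvgryPge: (x0c o) => /(_ A).
have [n _ nP] : \forall i \near \oo, A <= gromov_product o (x0 i) (x i).
  by move/cvgryPge: (xe o) => /(_ A).
have [m _ mP] : \forall i \near \oo, A <= gromov_product o (x0 i) (x' i).
  by move/cvgryPge: (xe' o) => /(_ A).
exists (maxn (maxn a b) (maxn n m)) => i j.
rewrite !geq_max => /andP[/andP[ai bi] /andP[ni mi]].
move=> /andP[/andP[aj bj] /andP[nj mj]].
have h1 : A <= gromov_product o (x0 i) (x0 j).
  by apply: (PQ (i, j)); split => /=; [exact: aP|exact: bQ].
have h2 : A <= gromov_product o (x i) (x0 i) by rewrite gromov_productC; exact: nP.
have h3 : A <= gromov_product o (x0 j) (x' j) by exact: mP.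
have h4 := gromov_product_ultra geoY delta0 thin h2 h1.
have h5 : A - delta <= gromov_product o (x0 j) (x' j).
  by apply: le_trans h3; move: delta0; lra.
have := gromov_product_ultra geoY delta0 thin h4 h5.
by rewrite /A; lra.
Qed.

End Hyperbolic_cat0.

(** * Limits of Gromov products at the boundary *)

Lemma boundary_nonempty (R : realType) (Y : metricType R) xi :
  boundary_at_infinity Y xi -> exists x, xi x.
Proof.
move=> [x xc <-]; exists x; split=> // o; apply/cvgryPge => A.
have [[P Q]/= [[a _ aP] [b _ bQ]] PQ] : \forall ij \near (\oo, \oo),
    A <= gromov_product o (x ij.1) (x ij.2).
  by move/cvgryPge: (xc o) => /(_ A).
(* The diagonal of the double limit shows that [x] is equivalent to itself. *)
exists (maxn a b) => //= i; rewrite /= geq_max => /andP[ai bi].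
by apply: (PQ (i, i)); split => /=; [exact: aP|exact: bQ].
Qed.

Theorem theorem8p1 (R : realType) (Y : metricType R) :
  proper_space Y -> gromov_hyperbolic Y -> cat0 Y -> boundary_continuous Y.
Proof.
move=> _ Yhyp Ycat o xi eta bxi beta.
have [delta delta0 thin] := hyperbolic_thin Yhyp.
have [geoY _] := Ycat.
have ultra := gromov_product_ultra geoY delta0 thin.
have close := boundary_gromov_product Ycat delta0 thin.
have [x0 xi0] := boundary_nonempty bxi.
have [y0 eta0] := boundary_nonempty beta.
pose g0 i := gromov_product o (x0 i) (y0 i).
(* Divergence for one pair of representatives means equal boundary points; it passes to any other
   pair along [x i], [x0 i], [y0 i], [y i]. *)
have [ginf|gfin] := pselect (g0 i @[i --> \oo] --> +oo).
  exists +oo%E; first exact: leey.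
  move=> x y xix etay; apply/cvgeryP/cvgryPge => A.
  have [n nP] := close _ bxi _ _ o (A + 2 * delta) xix xi0.
  have [m mP] := close _ beta _ _ o (A + 2 * delta) eta0 etay.
  have [k _ kP] : \forall i \near \oo, A + 2 * delta <= g0 i.
    by move/cvgryPge: ginf => /(_ (A + 2 * delta)).
  exists (maxn n (maxn m k)) => //= i; rewrite /= !geq_max => /and3P[ni mi ki].
  have h1 := ultra _ _ _ _ _ (nP i i ni ni) (kP i ki).
  have h2 : A + 2 * delta - delta <= gromov_product o (y0 i) (y i).
    by apply: le_trans (mP i i mi mi); lra.
  by have := ultra _ _ _ _ _ h1 h2; lra.
(* Non-divergence bounds [g0] only at arbitrarily late indices; [gM] upgrades this to an eventual
   bound. *)
have [B Bfreq] : exists B, forall n, exists2 j, (n <= j)%N & g0 j <= B.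
  apply: contrapT => unbounded; apply: gfin; apply/cvgryPge => A.
  apply: contrapT => hA; apply: unbounded; exists A => n.
  apply: contrapT => hn; apply: hA; exists n => // j nj /=.
  rewrite leNgt; apply/negP => jA; apply: hn; exists j => //; exact: ltW.
(* A larger product at [i] would force [g0 j > B] along the chain [x0 j], [x i], [y i], [y0 j], for
   a late [j] with [g0 j <= B]. *)
have gM x y : xi x -> eta y -> exists N, forall i, (N <= i)%N ->
    gromov_product o (x i) (y i) <= B + 2 * delta.
  move=> xix etay.
  have [n nP] := close _ bxi _ _ o (B + 2 * delta + 1) xi0 xix.
  have [m mP] := close _ beta _ _ o (B + 2 * delta + 1) etay eta0.
  exists (maxn n m) => i; rewrite geq_max => /andP[ni mi].
  have [j] := Bfreq (maxn n m); rewrite geq_max => /andP[nj mj] jB.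
  rewrite leNgt; apply/negP => lt_xy.
  set A := Num.min (B + 2 * delta + 1) (gromov_product o (x i) (y i)).
  have AB : B + 2 * delta < A by rewrite lt_min lt_xy andbT; lra.
  have h1 : A <= gromov_product o (x0 j) (x i).
    by rewrite (le_trans _ (nP j i nj ni))// ge_min lexx.
  have h2 : A <= gromov_product o (x i) (y i) by rewrite ge_min lexx orbT.
  have h3 : A - delta <= gromov_product o (y i) (y0 j).
    apply: le_trans (mP i j mi mj).
    have : A <= B + 2 * delta + 1 by rewrite ge_min lexx.
    by lra.
  have := ultra _ _ _ _ _ (ultra _ _ _ _ _ h1 h2) h3.
  by move: jB; rewrite /g0; lra.
(* The independent indices let this give both the Cauchy property of [g0] and, used in both
   directions, the common limit. *)
have gclose x y x' y' eps : xi x -> eta y -> xi x' -> eta y' -> 0 < eps ->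
    exists N, forall i j, (N <= i)%N -> (N <= j)%N ->
    gromov_product o (x i) (y i) - eps <= gromov_product o (x' j) (y' j).
  move=> xix etay xix' etay' eps0.
  have [T TP] := gromov_product_close Ycat delta0 thin (B + 2 * delta) eps0.
  have [k kP] := gM _ _ xix etay.
  have [n nP] := close _ bxi _ _ o T xix xix'.
  have [m mP] := close _ beta _ _ o T etay etay'.
  exists (maxn k (maxn n m)) => i j; rewrite !geq_max.
  move=> /and3P[ki ni mi] /and3P[_ nj mj].
  by apply: TP; [exact: kP|exact: nP|exact: mP].
have g0cvg : cvg (g0 i @[i --> \oo]).
  apply/cauchy_cvgP/cauchy_exP => eps eps0.
  have eps2 : 0 < eps / 2 by rewrite divr_gt0.
  have [N NP] := gclose _ _ _ _ _ xi0 eta0 xi0 eta0 eps2.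
  exists (g0 N), N => // i /= Ni; rewrite -ball_normE /= ltr_norml.
  by have := NP _ _ (leqnn N) Ni; have := NP _ _ Ni (leqnn N); rewrite /g0; lra.
exists (lim (g0 i @[i --> \oo]))%:E.
  rewrite lee_fin; apply: limr_ge => //.
  by apply: nearW => i; exact: gromov_product_ge0.
move=> x y xix etay.
apply/fine_cvgP; split; first exact: nearW.
apply/cvgrPdist_le => eps eps0.
have eps2 : 0 < eps / 2 by rewrite divr_gt0.
have [N NP] := gclose _ _ _ _ _ xix etay xi0 eta0 eps2.
have [N' NP'] := gclose _ _ _ _ _ xi0 eta0 xix etay eps2.
have [k _ kP] : \forall i \near \oo, `|lim (g0 j @[j --> \oo]) - g0 i| <= eps / 2.
  by move/cvgrPdist_le: g0cvg; apply.
exists (maxn N (maxn N' k)) => // i; rewrite /= !geq_max => /and3P[Ni N'i ki].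
have := kP i ki; have := NP i i Ni Ni; have := NP' i i N'i N'i.
by rewrite !ler_norml /g0; lra.
Qed.
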